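(* Let $X$ be a random vector in $\mathbb{R}^d$, $d \ge 1$, and let $L$ be a hyperplane in $\mathbb{R}^d$ supporting $C_X$ and such that $0 < \mathbb{P}(X \in L) < 1$. Let $X|L$ be a random vector distributed as $X$ conditioned on the event $\{X \in L\}$, and let $\mathrm{Pr}_L$ denote the orthogonal projection from $\mathbb{R}^d$ onto $L$. Then $$I_X(v) = I_{X|L}(v) - \log \mathbb{P}(X \in L) \quad \text{for all } v \in L$$ if and only if $$\mathrm{Pr}_L\bigl(\operatorname{rint} \mathcal{D}(K_X)\bigr) = \mathrm{Pr}_L\bigl(\operatorname{rint} \mathcal{D}(K_{X|L})\bigr).$$
   Context: For a random vector $Y$ in $\mathbb{R}^d$: $K_Y(u) := \log \mathbb{E} e^{u \cdot Y} \in (-\infty, +\infty]$ for $u \in \mathbb{R}^d$ (logarithmic Laplace transform); $I_Y(v) := \sup_{u \in \mathbb{R}^d} (u \cdot v - K_Y(u)) \in [0, +\infty]$ for $v \in \mathbb{R}^d$ (rate function). For a function $f:\mathbb{R}^d \to (-\infty, +\infty]$, its effective domain is $\mathcal{D}(f) := \{u \in \mathbb{R}^d : f(u) < +\infty\}$. For $A \subset \mathbb{R}^d$, $\operatorname{rint} A$ is the interior of $A$ in the relative topology of its affine hull. The topological support $\operatorname{supp} X$ is the smallest closed set $S$ with $\mathbb{P}(X \in S) = 1$, and the convex support of $X$ is $C_X := \operatorname{conv}(\operatorname{supp} X)$ (convex hull, not necessarily closed). Hyperplanes are affine (not necessarily through $0$). A hyperplane $L$ supports a convex set $C$ if $L \cap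 C \ne \varnothing$ and $C$ is contained in one of the two closed half-spaces bounded by $L$ ($C \subset L$ is allowed). *)

(* Defs.v *)
From HB Require Import structures.
From mathcomp Require Import all_boot all_order all_algebra.
From mathcomp Require Import all_classical all_reals all_analysis.
Import Order.TTheory GRing.Theory Num.Theory.
Import numFieldNormedType.Exports.

Set Implicit Arguments.
Unset Strict Implicit.
Unset Printing Implicit Defensive.

Local Open Scope classical_set_scope.
Local Open Scope ring_scope.

(* R^d with its Borel sigma-algebra; the carrier is convertible to 'rV[R]_d,
   whose library topology (the one of the max norm) is the Euclidean one. *)
Definition borelRV (R : realType) (d : nat) :=
  g_sigma_algebraType (@open 'rV[R]_d).

HB.instance Definition _ (R : realType) (d : nat) :=
  Measurable.on (borelRV R d).

Definition dot (R : realType) (d : nat) (u v : 'rV[R]_d) : R :=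
  \sum_(i < d) u 0 i * v 0 i.

Section RandomVector.
Context {disp : measure_display} {T : measurableType disp} {R : realType}.
Context {d : nat} (P : probability T R) (Y : {RV P >-> borelRV R d}).

Definition logLaplace (u : 'rV[R]_d) : \bar R :=
  lne ('E_P[fun w => expR (dot u (Y w))])%E.

Definition rate_fun (v : 'rV[R]_d) : \bar R :=
  ereal_sup [set ((dot u v)%:E - logLaplace u)%E | u in [set: 'rV[R]_d]].

(* R^d being second countable, this intersection is itself a closed set of
   probability 1. *)
Definition tsupp : set 'rV[R]_d :=
  \bigcap_(S in [set S : set 'rV[R]_d | closed S /\ P (Y @^-1` S) = 1%E]) S.

Definition convex_support : set 'rV[R]_d :=
  smallest (@convex_set R 'rV[R]_d) tsupp.

End RandomVector.

Arguments tsupp {disp T R d} P Y.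
Arguments convex_support {disp T R d} P Y.
Arguments logLaplace {disp T R d} P Y u.
Arguments rate_fun {disp T R d} P Y v.

(* Equality in law of Y, possibly living on another probability space, with X
   conditioned on {X \in L}. *)
Definition conditioned_on {disp disp' : measure_display}
    {T : measurableType disp} {T' : measurableType disp'} {R : realType}
    {d : nat} (P : probability T R) (X : {RV P >-> borelRV R d})
    (L : set 'rV[R]_d)
    (P' : probability T' R) (Y : {RV P' >-> borelRV R d}) : Prop :=
  forall A : set (borelRV R d), measurable A ->
    P' (Y @^-1` A) = (P (X @^-1` A `&` X @^-1` L) / P (X @^-1` L))%E.

Arguments conditioned_on {disp disp' T T' R d} P X L P' Y.

Section Geometry.
Context {R : realType} {d : nat}.
Implicit Types (A C L : set 'rV[R]_d) (x : 'rV[R]_d).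

Definition effdom (f : 'rV[R]_d -> \bar R) : set 'rV[R]_d :=
  [set u | (f u < +oo)%E].

Definition affine_set A : Prop :=
  forall x y (t : R), A x -> A y -> A ((1 - t) *: x + t *: y).

Definition affine_hull A : set 'rV[R]_d := smallest affine_set A.

(* In [subspace B] the points outside B are isolated; this is harmless here
   because A `<=` affine_hull A, see [rintP]. *)
Definition rint A : set 'rV[R]_d := @interior (subspace (affine_hull A)) A.

Definition hyperplane (a : 'rV[R]_d) (b : R) : set 'rV[R]_d :=
  [set x | dot a x = b].

Definition halfspace (a : 'rV[R]_d) (b : R) : set 'rV[R]_d :=
  [set x | dot a x <= b].

(* (a, b) and (- a, - b) define the same hyperplane and its two closed
   half-spaces. *)
Definition supporting_hyperplane L C : Prop :=
  L `&` C !=set0 /\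
  exists a b, [/\ a != 0, L = hyperplane a b & C `<=` halfspace a b].

Definition orthoproj L x : 'rV[R]_d :=
  get [set p | L p /\ forall y, L y -> dot (x - p) (y - p) = 0].

Lemma sub_affine_hull A : A `<=` affine_hull A.
Proof. exact: sub_smallest. Qed.

Lemma rintP A x :
  rint A x <->
  A x /\ exists2 e : R, 0 < e & ball x e `&` affine_hull A `<=` A.
Proof.
have nbhsE y : affine_hull A y ->
    nbhs (y : subspace (affine_hull A)) = within (affine_hull A) (nbhs y).
  by move=> Ay; exact: esym (nbhs_subspace_in Ay).
split=> [Ax|[Ax [e e0 eA]]].
  have Ax' : A x := @interior_subset (subspace (affine_hull A)) A x Ax.
  split=> //; move: Ax.
  rewrite /rint /interior /= (nbhsE _ (sub_affine_hull Ax')).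
  move=> /nbhs_ballP[e /= e0 eA]; exists e => // y [xy Ay].
  exact: eA.
rewrite /rint /interior /= (nbhsE _ (sub_affine_hull Ax)).
by apply/nbhs_ballP; exists e => //= y xy Ay; apply: eA.
Qed.

Lemma orthoproj_hyperplane (a : 'rV[R]_d) (b : R) x : a != 0 ->
  orthoproj (hyperplane a b) x = x - ((dot a x - b) / dot a a) *: a.
Proof.
have dotBr (u v w : 'rV[R]_d) : dot u (v - w) = dot u v - dot u w.
  by rewrite /dot -sumrB; apply: eq_bigr => i _; rewrite !mxE mulrBr.
have dotZr (u v : 'rV[R]_d) c : dot u (c *: v) = c * dot u v.
  by rewrite /dot mulr_sumr; apply: eq_bigr => i _; rewrite !mxE mulrCA.
have dotC (u v : 'rV[R]_d) : dot u v = dot v u.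
  by apply: eq_bigr => i _; rewrite mulrC.
have dot_eq0 (u : 'rV[R]_d) : dot u u = 0 -> u = 0.
  move=> /eqP; rewrite /dot psumr_eq0 => [|i _]; last by rewrite -expr2 sqr_ge0.
  move=> /allP u0; apply/rowP => i; rewrite mxE; apply/eqP.
  by have := u0 i (mem_index_enum _); rewrite mulf_eq0 orbb.
move=> a0; have aa0 : dot a a != 0 by apply: contra a0 => /eqP/dot_eq0 ->.
set c := _ / _; have ac : c * dot a a = dot a x - b by rewrite /c divfK.
have Lp : dot a (x - c *: a) = b by rewrite dotBr dotZr ac subKr.
apply: xget_unique.
  split=> // y Ly; rewrite subKr dotC dotZr dotC dotBr Lp.
  by rewrite (_ : dot a y = b) ?subrr ?mulr0.
move=> q [Lq qP]; pose u := x - c *: a - q.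
have au : dot a u = 0 by rewrite dotBr Lp (_ : dot a q = b) ?subrr.
have uE : u = (x - q) - c *: a by rewrite /u addrAC.
apply/eqP; rewrite eq_sym -subr_eq0; apply/eqP/dot_eq0; rewrite -/u.
by rewrite [X in dot _ X]uE dotBr dotZr dotC (qP _ Lp) dotC au mulr0 subrr.
Qed.

End Geometry.

(* Main.v *)
(** Write L = {a . x = b}, p = P(X in L), F(u) = E e^{u.X} and
    G(u) = E e^{u.(X|L)}, with effective domains D and D_L.  As a . X <= b almost
    surely, e^{-nb} F(u + na) decreases to p G(u) as n grows, while
    G(u + ta) = e^{tb} G(u).  Hence, for v in L, the supremum defining
    I_X(v) + log p is that of J(u) = u.v - log G(u) over S = D + Ra, whereas
    I_{X|L}(v) is the supremum of J over D_L, which contains S and satisfies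
    D_L + Ra = D_L.  If the projections agree, then rint D_L is included in S,
    and both suprema agree because J(u) is recovered along a segment from u to
    a point of rint D_L.  Conversely, if u in D_L is not in the closure of S, a
    vector w strictly separating u from S is orthogonal to a; moving v to v + sw
    inside L makes the supremum over D_L outgrow the one over S as s grows, so S
    is dense in D_L, and convex sets with the same closure have the same
    relative interior. *)

Require Import Defs.
From mathcomp Require Import all_boot all_order all_algebra.
From mathcomp Require Import all_classical all_reals all_analysis.
From mathcomp Require Import measurable_realfun ring lra.
Import Order.TTheory GRing.Theory Num.Theory.
Import numFieldNormedType.Exports.

Set Implicit Arguments.
Unset Strict Implicit.
Unset Printing Implicit Defensive.

Local Open Scope classical_set_scope.
Local Open Scope ring_scope.

(** * Convex sets in R^d *)

Section Dot.
Context {R : realType} {d : nat}.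
Implicit Types (u v w : 'rV[R]_d) (c : R).

Lemma dotC u v : dot u v = dot v u.
Proof. by apply: eq_bigr => i _; rewrite mulrC. Qed.

Lemma dotDr u v w : dot u (v + w) = dot u v + dot u w.
Proof. by rewrite /dot -big_split; apply: eq_bigr => i _; rewrite !mxE mulrDr. Qed.

Lemma dotZr u v c : dot u (c *: v) = c * dot u v.
Proof. by rewrite /dot mulr_sumr; apply: eq_bigr => i _; rewrite !mxE mulrCA. Qed.

Lemma dotDl u v w : dot (u + v) w = dot u w + dot v w.
Proof. by rewrite dotC dotDr !(dotC w). Qed.

Lemma dotZl u v c : dot (c *: u) v = c * dot u v.
Proof. by rewrite dotC dotZr dotC. Qed.

Lemma dotBr u v w : dot u (v - w) = dot u v - dot u w.
Proof. by rewrite dotDr -scaleN1r dotZr mulN1r. Qed.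

Lemma dotBl u v w : dot (u - v) w = dot u w - dot v w.
Proof. by rewrite dotC dotBr !(dotC w). Qed.

Lemma dot0l u : dot 0 u = 0.
Proof. by rewrite -(scale0r 0) dotZl mul0r. Qed.

Lemma dotr_ge0 u : 0 <= dot u u.
Proof. by apply: sumr_ge0 => i _; rewrite -expr2 sqr_ge0. Qed.

Lemma dot_subZ u v c :
  dot (u - c *: v) (u - c *: v) = dot u u - 2 * c * dot u v + c ^+ 2 * dot v v.
Proof. rewrite dotBl !dotBr !dotZl !dotZr (dotC v u); ring. Qed.

Lemma dotr_eq0 u : (dot u u == 0) = (u == 0).
Proof.
apply/idP/idP => [|/eqP ->]; last by rewrite dot0l.
rewrite /dot psumr_eq0 => [/allP u0|i _]; last by rewrite -expr2 sqr_ge0.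
apply/eqP/rowP => i; rewrite mxE; apply/eqP.
by have := u0 i (mem_index_enum _); rewrite mulf_eq0 orbb.
Qed.

Lemma dotr_gt0 u : u != 0 -> 0 < dot u u.
Proof. by move=> u0; rewrite lt_neqAle eq_sym dotr_eq0 u0 dotr_ge0. Qed.

Lemma ler_coord_norm u i : `|u 0 i| <= `|u|.
Proof.
rewrite [leRHS]/Num.norm /= mx_normrE.
by apply/bigmax_geP; right => /=; exists (0, i).
Qed.

(** A crude bound, from t <= 1 + t^2 at a coordinate attaining the max norm; it makes sublevel sets
    of the squared Euclidean distance bounded. *)
Lemma ler_norm_dotxx u : `|u| <= 1 + dot u u.
Proof.
have [->|u0] := eqVneq u 0; first by rewrite normr0 dot0l addr0.
have /mx_norm_neq0[[i j] /=] : mx_norm u != 0 by rewrite (normr_eq0 u).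
rewrite ord1 => uE; rewrite [leLHS]uE.
have : `|u 0 j| ^+ 2 <= dot u u.
  rewrite /dot (bigD1 j)//= real_normK ?num_real// expr2 lerDl.
  by apply: sumr_ge0 => k _; rewrite -expr2 sqr_ge0.
have := normr_ge0 (u 0 j); nra.
Qed.

Lemma ler_norm_dot u v : `|dot u v| <= (\sum_i `|u 0 i|) * `|v|.
Proof.
rewrite (le_trans (ler_norm_sum _ _ _)) // mulr_suml; apply: ler_sum => i _.
by rewrite normrM ler_wpM2l // ler_coord_norm.
Qed.

Lemma continuous_dotl u : continuous (dot u).
Proof.
move=> v; apply: (@cvg_big _ _ _ _ _ _ _ (nbhs v)) => [|i _]; first exact: add_continuous.
by apply: cvgMl_tmp; exact: coord_continuous.
Qed.

Lemma continuous_dotxx : continuous (fun u : 'rV[R]_d => dot u u).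
Proof.
move=> v; apply: (@cvg_big _ _ _ _ _ _ _ (nbhs v)) => [|i _]; first exact: add_continuous.
by apply: cvgM; exact: coord_continuous.
Qed.

End Dot.

(** * Affine hulls, relative interiors and separation *)

Section ConvexSets.
Context {R : realType} {d : nat}.
Implicit Types (C S E : set 'rV[R]_d) (x y z w : 'rV[R]_d).

Definition is_convex C :=
  forall x y (t : R), 0 <= t <= 1 -> C x -> C y -> C ((1 - t) *: x + t *: y).

Lemma affine_hull_affine C : affine_set (affine_hull C).
Proof.
by move=> x y t Cx Cy A hA; apply: hA.1; [exact: Cx | exact: Cy].
Qed.

Lemma affine_hull_sub C A : affine_set A -> C `<=` A -> affine_hull C `<=` A.
Proof. by move=> Aaff CA; exact: smallest_sub. Qed.

(** Induction merges two weighted directions into their weighted mean, which is again of the form y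
    - x with y in C; a zero total weight is treated apart. *)
Lemma convex_sum C x I (s : seq I) (c : I -> R) (w : I -> 'rV[R]_d) :
  is_convex C -> C x -> (forall i, 0 <= c i) -> (forall i, C (x + w i)) ->
  exists2 y, C y &
    \sum_(i <- s) c i *: w i = (\sum_(i <- s) c i) *: (y - x).
Proof.
move=> cC Cx c0 Cw; elim: s => [|i s [y Cy IH]].
  by exists x => //; rewrite !big_nil subrr scaler0.
rewrite !big_cons IH; set T := \sum_(j <- s) c j.
have T0 : 0 <= T by apply: sumr_ge0.
have [cT0|cT0] := eqVneq (c i + T) 0.
  exists x => //; rewrite subrr scaler0.
  have := c0 i => ci0.
  have -> : c i = 0 by lra.
  have -> : T = 0 by lra.
  by rewrite !scale0r addr0.
have cT : 0 < c i + T by rewrite lt_neqAle eq_sym cT0 addr_ge0.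
exists ((1 - c i / (c i + T)) *: y + (c i / (c i + T)) *: (x + w i)).
  by apply: cC => //; rewrite divr_ge0 ?(ltW cT)//= ler_pdivrMr// mul1r lerDl.
by apply/rowP => j; rewrite !mxE; field.
Qed.

Lemma affine_set_sum A x I (s : seq I) (c : I -> R) (w : I -> 'rV[R]_d) :
  affine_set A -> A x -> (forall i, A (x + w i)) ->
  A (x + \sum_(i <- s) c i *: w i).
Proof.
move=> affA Ax Aw; elim: s => [|i s IH]; first by rewrite big_nil addr0.
rewrite big_cons; set y := \sum_(j <- s) _ in IH *.
(* Only two-point affine combinations are available: x + p + q is the reflection of x in the
   midpoint of x + p and x + q. *)
have -> : x + (c i *: w i + y) =
    (1 - 2) *: x + 2 *: ((1 - 2^-1) *: ((1 - c i) *: x + c i *: (x + w i)) +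
                          2^-1 *: (x + y)).
  by apply/rowP => j; rewrite !mxE; field.
by apply: (affA) => //; apply: (affA) => //; apply: affA.
Qed.

(** A linearly independent family of such directions of maximal size works: a y - x outside its span
    could be appended to it. *)
Lemma exists_spanning_directions C x : C x ->
  exists r, exists2 B : 'M[R]_(r, d), (forall i, C (x + row i B)) &
    forall y, C y -> (y - x <= B)%MS.
Proof.
move=> Cx.
pose Q r := `[< exists2 B : 'M[R]_(r, d), row_free B &
  forall i, C (x + row i B) >].
have Q0 : exists r, Q r.
  exists 0%N; apply/asboolP; exists 0; first by rewrite /row_free mxrank0.
  by case.
have Qd r : Q r -> (r <= d)%N.
  by move=> /asboolP[B + _] => /eqP <-; exact: rank_leq_col.
case: (ex_maxnP Q0 Qd) => r /asboolP[B Bfree CB] Bmax.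
exists r, B => // y Cy; apply: contraT => yB.
suff /Bmax : Q (r + 1)%N by rewrite addn1 ltnn.
apply/asboolP; exists (col_mx B (y - x)).
  have lt_rank : (\rank B < \rank (B + (y - x)%R)%MS)%N.
    apply: rank_ltmx; rewrite /ltmx addsmxSl; apply: contra yB.
    by apply: submx_trans; exact: addsmxSr.
  rewrite /row_free eqn_leq rank_leq_row -addsmxE /=.
  by rewrite (leq_trans _ lt_rank)// (eqP Bfree) addn1.
move=> i; case: (split_ordP i) => j ->.
  by rewrite rowKu.
rewrite rowKd (_ : row j _ = y - x) 1?addrC ?subrK//.
by apply/rowP => k; rewrite !mxE ord1.
Qed.

Lemma affine_hull_rowspaceE C x r (B : 'M[R]_(r, d)) : C x ->
  (forall i, C (x + row i B)) -> (forall y, C y -> (y - x <= B)%MS) ->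
  affine_hull C = [set y | (y - x <= B)%MS].
Proof.
move=> Cx CB BC; apply/seteqP; split=> [|y /= yB].
  apply: affine_hull_sub => // y z t /= yB zB.
  rewrite (_ : _ - x = (1 - t) *: (y - x) + t *: (z - x)).
    by rewrite addmx_sub// scalemx_sub.
  by apply/rowP => j; rewrite !mxE; ring.
rewrite -(subrK x y) addrC -(mulmxKpV yB) mulmx_sum_row.
apply: affine_set_sum (@affine_hull_affine C) _ _ => [|i];
  exact: sub_affine_hull.
Qed.

Lemma closed_dot_eq (u : 'rV[R]_d) (b : R) : closed [set y | dot u y = b].
Proof.
apply: (@closed_comp _ _ (dot u) [set t | t = b]); last exact: closed_eq.
by move=> y _; exact: continuous_dotl.
Qed.

(** The row space of B is the kernel of [cokermx B], so a nonempty hull is a finite intersection of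
    hyperplanes. *)
Lemma closed_affine_hull C : closed (affine_hull C).
Proof.
have [[x Cx]|C0] := pselect (C !=set0); last first.
  suff -> : affine_hull C = set0 by exact: closed0.
  rewrite -subset0; apply: affine_hull_sub => // x Cx.
  by apply: C0; exists x.
have [r [B CB BC]] := exists_spanning_directions Cx.
rewrite (affine_hull_rowspaceE Cx CB BC).
set M := cokermx B.
have -> : [set y | (y - x <= B)%MS] =
    \bigcap_(k in [set: 'I_d]) [set y | dot (col k M)^T y = dot (col k M)^T x].
  apply/seteqP; split=> y /=; rewrite submxE -/M.
    move=> /eqP yx0 k _ /=; apply/eqP; rewrite -subr_eq0 -dotBr; apply/eqP.
    have /rowP/(_ k) := yx0; rewrite !mxE => <-.
    by apply: eq_bigr => i _; rewrite !mxE mulrC.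
  move=> yx; apply/eqP/rowP => k; rewrite [RHS]mxE.
  have /eqP := yx k I; rewrite /= -subr_eq0 -dotBr => /eqP <-.
  by rewrite !mxE; apply: eq_bigr => i _; rewrite !mxE mulrC.
by apply: closed_bigI => k _; exact: closed_dot_eq.
Qed.

Lemma closure_affine_hull C : closure C `<=` affine_hull C.
Proof.
rewrite [X in _ `<=` X](iffLR (closure_id _)); last exact: closed_affine_hull.
by apply: closure_subset; exact: sub_affine_hull.
Qed.

(** C contains the simplex with vertices x and the x + [row i B], which spans the affine hull; its
    barycentre, with all weights [rho] = 1/(r+1), is relatively interior. *)
Lemma convex_rint_nonempty C : is_convex C -> C !=set0 -> rint C !=set0.
Proof.
move=> cC [x Cx].
have [r [B CB BC]] := exists_spanning_directions Cx.
have affE := affine_hull_rowspaceE Cx CB BC.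
pose rho : R := r.+1%:R^-1.
have rho0 : 0 < rho by rewrite invr_gt0.
have simplex (c : 'I_r -> R) : (forall i, 0 <= c i) -> \sum_i c i <= 1 ->
    C (x + \sum_i c i *: row i B).
  move=> c0 c1.
  have [y Cy ->] := convex_sum (index_enum 'I_r) cC Cx c0 CB.
  rewrite (_ : x + _ = (1 - \sum_i c i) *: x + (\sum_i c i) *: y).
    by apply: cC => //; rewrite c1 sumr_ge0.
  by apply/rowP => j; rewrite !mxE; ring.
pose K := \sum_(i < r) \sum_(j < d) `|pinvmx B j i|.
have K0 : 0 <= K by apply: sumr_ge0 => i _; apply: sumr_ge0.
(* With this radius the coordinates m_i of y - z in the rows of [B] are at most [rho]^2 in size.
   Hence [rho] + m_i >= 0, and their sum is at most r ([rho] + [rho]^2) = 1 - [rho]^2. *)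
pose e := rho ^+ 2 / (K + 1).
have e0 : 0 < e by rewrite divr_gt0 ?exprn_gt0// ltr_wpDl.
exists (x + \sum_(i < r) rho *: row i B); apply/rintP; split.
  apply: simplex => [i|]; first exact: ltW.
  by rewrite sumr_const card_ord -[_ *+ r]mulr_natl ler_pdivrMr// mul1r ler_nat.
exists e => // y [].
rewrite -ball_normE /= affE /= => yz yB.
set z := x + _ in yz.
have zB : (z - x <= B)%MS.
  by rewrite addrC addKr summx_sub// => i _; rewrite scalemx_sub// row_sub.
have yzB : (y - z <= B)%MS.
  have -> : y - z = (y - x) - (z - x) by rewrite opprB addrA subrK.
  by apply: addmx_sub => //; rewrite eqmx_opp.
pose m := (y - z) *m pinvmx B.
have mB i : `|m 0 i| <= rho ^+ 2.
  rewrite mxE; have -> : \sum_j (y - z) 0 j * pinvmx B j i =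
      dot (col i (pinvmx B))^T (y - z).
    by apply: eq_bigr => j _; rewrite !mxE mulrC.
  apply: (le_trans (ler_norm_dot _ _)).
  rewrite -normrN opprB.
  apply: (@le_trans _ _ ((K + 1) * e)); last by rewrite /e mulrC divfK// gt_eqF// ltr_wpDl.
  apply: ler_pM => //; [exact: sumr_ge0| |exact: ltW].
  under eq_bigr do rewrite 2!mxE.
  rewrite /K [X in _ <= X + 1](bigD1 i)//= -addrA. rewrite lerDl addr_ge0//.
  by apply: sumr_ge0 => k _; apply: sumr_ge0.
have -> : y = x + \sum_i (rho + m 0 i) *: row i B.
  under eq_bigr do rewrite scalerDl.
  rewrite big_split /= addrA -/z -mulmx_sum_row mulmxKpV//.
  by rewrite addrC subrK.
have rhoE : r%:R = rho^-1 - 1 by rewrite invrK -natr1 addrK.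
apply: simplex => [i|].
  have := mB i; rewrite ler_norml => /andP[+ _].
  have : rho <= 1 by rewrite invf_le1// ler1n.
  nra.
apply: (@le_trans _ _ (\sum_(i < r) (rho + rho ^+ 2))).
  apply: ler_sum => i _; rewrite lerD2l.
  by have := mB i; rewrite ler_norml => /andP[].
rewrite sumr_const card_ord -[_ *+ r]mulr_natl rhoE.
rewrite (_ : _ * _ = 1 - rho ^+ 2) ?gerBl ?exprn_ge0 ?ltW//.
by field; rewrite gt_eqF.
Qed.

Lemma closure_approx C w (e : R) : closure C w -> 0 < e ->
  exists2 w', C w' & `|w - w'| < e.
Proof.
move=> Cw e0; have [w' [Cw' ww']] := Cw _ (nbhsx_ballx w e e0).
by exists w' => //; move: ww'; rewrite -ball_normE.
Qed.

(** A point y of the hull near x is written (1 - s) z' + s w', where w' in C approximates w; then z'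
    is close to z, hence in C. *)
Lemma rint_segment C z w (s : R) : is_convex C -> rint C z -> closure C w ->
  0 <= s < 1 -> rint C ((1 - s) *: z + s *: w).
Proof.
move=> cC /rintP[Cz [e e0 zC]] Cw /andP[s0 s1].
set x := _ + _.
(* Solving for z' divides errors by 1 - s. The radius e' allots half of e (1 - s) to y and half to
   w'. *)
have s1' : 0 < 1 - s by rewrite subr_gt0.
have affx : affine_hull C x.
  apply: affine_hull_affine; first exact: sub_affine_hull.
  exact: closure_affine_hull.
pose e' := e * (1 - s) / 2.
have e'0 : 0 < e' by rewrite !mulr_gt0 ?invr_gt0.
have near_x y : `|x - y| < e' -> affine_hull C y -> C y.
  move=> xy affy; have [w' Cw' ww'] := closure_approx Cw e'0.
  pose z' := (1 - - (s / (1 - s))) *: y + (- (s / (1 - s))) *: w'.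
  have -> : y = (1 - s) *: z' + s *: w'.
    by apply/rowP => i; rewrite !mxE; field; rewrite gt_eqF.
  apply: cC; rewrite ?s0 ?ltW//; apply: zC; split; last first.
    by apply: affine_hull_affine => //; exact: sub_affine_hull.
  rewrite -ball_normE /=.
  have -> : z - z' = (1 - s)^-1 *: ((x - y) - s *: (w - w')).
    by apply/rowP => i; rewrite !mxE; field; rewrite gt_eqF.
  rewrite normrZ gtr0_norm ?invr_gt0// mulrC ltr_pdivrMr//.
  apply: (le_lt_trans (ler_normB _ _)); rewrite normrZ ger0_norm//.
  have sww' : s * `|w - w'| <= `|w - w'| by rewrite ler_piMl// ltW.
  rewrite (_ : e * _ = e' + e'); last by rewrite /e'; field.
  by rewrite ltrD// (le_lt_trans sww').
apply/rintP; split; first by apply: near_x; rewrite ?subrr ?normr0.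
by exists e' => // y []; rewrite -ball_normE => /near_x.
Qed.

Lemma rint_extend C x y : rint C x -> affine_hull C y ->
  exists2 e : R, 0 < e & C (x + e *: (x - y)).
Proof.
move=> /rintP[Cx [e e0 xC]] affy.
have N0 : 0 < `|x - y| + 1 by rewrite ltr_wpDl.
(* The + 1 covers the case x = y. *)
exists (e / (`|x - y| + 1)); first by rewrite divr_gt0.
set t := e / _; apply: xC; split.
  rewrite -ball_normE /= opprD addNKr normrN normrZ gtr0_norm ?divr_gt0//.
  by rewrite mulrAC ltr_pdivrMr// ltr_pM2l// ltrDl.
rewrite (_ : _ + _ = (1 - - t) *: x + (- t) *: y).
  by apply: affine_hull_affine => //; exact: sub_affine_hull.
by apply/rowP => i; rewrite !mxE; ring.
Qed.

(** With [rint_extend], this characterises relative interior points by prolongation of segments: x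
    divides the segment from z to the prolonged point at parameter 1/(1 + e). *)
Lemma between_rint C x z (e : R) : is_convex C -> rint C z -> 0 < e ->
  closure C (x + e *: (x - z)) -> rint C x.
Proof.
move=> cC Cz e0 Cw.
have e1 : 1 + e != 0 by rewrite gt_eqF// ltr_wpDl// ltW.
have := rint_segment (s := 1 / (1 + e)) cC Cz Cw.
rewrite (_ : _ *: z + _ = x); last by apply/rowP => i; rewrite !mxE; field.
apply; rewrite divr_ge0 ?addr_ge0 ?ltW//= ltr_pdivrMr ?mul1r ?ltrDl//.
by rewrite ltr_wpDr// ltW.
Qed.

Lemma rint_sub C : rint C `<=` C.
Proof. by move=> x /rintP[]. Qed.

(** E lies in the closed affine hull of S, so both hulls agree, which gives one inclusion. For the
    other, a segment from a point of [rint S] through x is prolonged inside E, hence inside the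
    closure of S. *)
Lemma rint_dense_eq S E : is_convex S -> is_convex E ->
  S `<=` E -> E `<=` closure S -> rint S = rint E.
Proof.
move=> cS cE SE ES; apply/seteqP; split=> x Sx.
  have /rintP[Sx' [e e0 xS]] := Sx.
  apply/rintP; split; first exact: SE.
  exists e => // y [xy Ey]; apply/SE/xS; split=> //.
  apply: affine_hull_sub Ey; first exact: affine_hull_affine.
  exact: subset_trans ES (@closure_affine_hull S).
have [z Sz] : rint S !=set0.
  apply: convex_rint_nonempty => //.
  have [y [Sy _]] := ES _ (rint_sub Sx) _ filterT.
  by exists y.
have [e e0 Ew] := rint_extend Sx (sub_affine_hull (SE _ (rint_sub Sz))).
exact: between_rint cS Sz e0 (ES _ Ew).
Qed.

(** The Minkowski sum C + Ra, the union of the lines of direction a that meet C. *)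
Definition add_line C a : set 'rV[R]_d :=
  [set x | exists t : R, C (x + t *: a)].

Lemma add_line_convex C a : is_convex C -> is_convex (add_line C a).
Proof.
move=> cC x y s s01 [t Ct] [t' Ct']; exists ((1 - s) * t + s * t').
have := cC _ _ _ s01 Ct Ct'; congr (C _).
by apply/rowP => i; rewrite !mxE; ring.
Qed.

(** Both inclusions use prolongation of segments, with the shift along a carried along. *)
Lemma rint_add_line C a : is_convex C ->
  rint (add_line C a) = add_line (rint C) a.
Proof.
move=> cC; apply/seteqP; split=> x.
  move=> Sx; have [t0 Ct0] := rint_sub Sx.
  have [z Cz] : rint C !=set0.
    by apply: convex_rint_nonempty => //; exists (x + t0 *: a).
  have Sz : add_line C a z by exists 0; rewrite scale0r addr0; exact: rint_sub.
  have [e e0 [t Ct]] := rint_extend Sx (sub_affine_hull Sz).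
  have e1 : 1 + e != 0 by rewrite gt_eqF// ltr_wpDl// ltW.
  (* Prolonging from z by the factor 1 + e turns this shift of x into the shift t, which is known to
     land in C. *)
  exists (t / (1 + e)); apply: between_rint cC Cz e0 _.
  apply: subset_closure; move: Ct; congr (C _).
  by apply/rowP => i; rewrite !mxE; field.
move=> [t Cx].
have cS := @add_line_convex C a cC.
have [z Sz] : rint (add_line C a) !=set0.
  by apply: convex_rint_nonempty => //; exists x, t; exact: rint_sub.
have [t' Cz] := rint_sub Sz.
have [e e0 Cw] := rint_extend Cx (sub_affine_hull Cz).
apply: between_rint cS Sz e0 _; apply: subset_closure.
exists (t + e * (t - t')); move: Cw; congr (C _).
by apply/rowP => i; rewrite !mxE; ring.
Qed.

Lemma closure_convex C : is_convex C -> is_convex (closure C).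
Proof.
move=> cC x y t /andP[t0 t1] Cx Cy B /nbhs_ballP[e /= e0 xB].
have [x' Cx' xx'] := closure_approx Cx e0.
have [y' Cy' yy'] := closure_approx Cy e0.
exists ((1 - t) *: x' + t *: y'); split; first by apply: cC => //; rewrite t0.
apply: xB; rewrite -ball_normE /=.
rewrite (_ : _ - _ = (1 - t) *: (x - x') + t *: (y - y')); last first.
  by apply/rowP => i; rewrite !mxE; ring.
apply: (le_lt_trans (ler_normD _ _)).
rewrite !normrZ !ger0_norm ?subr_ge0//.
have [->|t_neq0] := eqVneq t 0; first by rewrite subr0 mul1r mul0r addr0.
have t0' : 0 < t by rewrite lt_neqAle eq_sym t_neq0.
nra.
Qed.

(** C may be unbounded, so the distance is minimised over the compact set of points of C no farther
    from x than z. *)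
Lemma closed_convex_min C x : closed C -> C !=set0 ->
  exists2 y, C y & forall z, C z -> dot (x - y) (x - y) <= dot (x - z) (x - z).
Proof.
move=> clC [z Cz].
pose A := C `&` [set y | dot (x - y) (x - y) <= dot (x - z) (x - z)].
have cont : continuous (fun y => dot (x - y) (x - y)).
  move=> y; apply: (@continuous_comp _ _ _ (fun y => x - y) (fun u => dot u u)).
    by apply: continuousB => //; exact: cst_continuous.
  exact: continuous_dotxx.
have compA : compact A.
  apply: bounded_closed_compact.
    exists (`|x| + (1 + dot (x - z) (x - z))); split; first exact: num_real.
    move=> M ltM y [_ /= yA]; apply: ltW; apply: le_lt_trans ltM.
    rewrite -[y](subKr x) (le_trans (ler_normB _ _))// lerD2l.
    by rewrite (le_trans (ler_norm_dotxx _))// lerD2l.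
  apply: closedI => //.
  apply: (@closed_comp _ _ (fun y => dot (x - y) (x - y))
    [set t | t <= dot (x - z) (x - z)]); last exact: closed_le.
  by move=> y _; exact: cont.
have [||y + ymin] := @EVT_min_rV R d (fun y => dot (x - y) (x - y)) A _ compA.
- by exists z; split=> /=.
- exact: continuous_subspaceT cont.
rewrite inE => -[Cy yz]; exists y => // z' Cz'.
have [z'A|/ltW] := leP (dot (x - z') (x - z')) (dot (x - z) (x - z)).
  by apply: ymin; rewrite inE; split.
exact: le_trans.
Qed.

(** The normal w joins the nearest point y of the closure to x. A point z of C beyond the hyperplane
    through y would allow a move from y towards z that reduces the distance to x. *)
Lemma convex_strict_separation C x : is_convex C -> C !=set0 -> ~ closure C x ->
  exists w (c : R), c < dot w x /\ forall y, C y -> dot w y <= c.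
Proof.
move=> cC C0 Cx.
have [y Cy ymin] : exists2 y, closure C y &
    forall z, closure C z -> dot (x - y) (x - y) <= dot (x - z) (x - z).
  apply: closed_convex_min; first exact: closed_closure.
  by have [z Cz] := C0; exists z; exact: subset_closure.
pose w := x - y.
have w0 : w != 0 by apply: contra_notN Cx; rewrite subr_eq0 => /eqP ->.
exists w, (dot w y); split.
  by rewrite -subr_gt0 -dotBr dotr_gt0.
move=> z /subset_closure Cz; rewrite leNgt; apply/negP => wzy.
pose v := z - y.
have v0 : v != 0.
  by apply: contraTN wzy; rewrite subr_eq0 => /eqP ->; rewrite ltxx.
have wv : 0 < dot w v by rewrite dotBr subr_gt0.
have vv : 0 < dot v v by rewrite dotr_gt0.
have dist t : dot (x - ((1 - t) *: y + t *: z)) (x - ((1 - t) *: y + t *: z)) =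
    dot w w - 2 * t * dot w v + t ^+ 2 * dot v v.
  rewrite (_ : x - _ = w - t *: v); last first.
    by apply/rowP => i; rewrite !mxE; ring.
  exact: dot_subZ.
(* The minimiser on [0, 1] of the squared distance, a quadratic in t. *)
pose t := Num.min 1 (dot w v / dot v v).
have t0 : 0 < t by rewrite lt_min ltr01 divr_gt0.
have t1 : t <= 1 by rewrite ge_min lexx.
have tv : t * dot v v <= dot w v by rewrite -ler_pdivlMr// ge_min lexx orbT.
have := ymin _ (closure_convex cC (t := t) _ Cy Cz).
rewrite (ltW t0) t1 dist => /(_ isT); rewrite -/w.
nra.
Qed.

End ConvexSets.

(** * Conjugates along a supporting hyperplane *)

Section ConvexDuality.
Context {R : realType} {d : nat}.
Implicit Types (u v w x y a : 'rV[R]_d).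

Lemma lne_lty (x : \bar R) : (lne x < +oo)%E = (x < +oo)%E.
Proof. by case: x => [r| |] //=; case: ifP; rewrite !ltry. Qed.

Lemma orthoproj_hyperplane_eq a (b : R) x y : a != 0 ->
  orthoproj (hyperplane a b) x = orthoproj (hyperplane a b) y <->
  exists t : R, y = x + t *: a.
Proof.
move=> a0; rewrite !orthoproj_hyperplane//; split=> [xy|[t ->]].
  exists ((dot a y - b) / dot a a - (dot a x - b) / dot a a).
  apply/eqP; rewrite scalerBl addrA addrAC -subr_eq; apply/eqP.
  by rewrite -xy; apply/rowP => i; rewrite !mxE; ring.
have aa : dot a a != 0 by rewrite dotr_eq0.
rewrite dotDr dotZr; apply/rowP => i; rewrite !mxE; field.
exact: aa.
Qed.

(** F and G abstract the moment generating functions of X and X|L, with p = P(X in L). The bound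
    [G_ge] makes G positive and bounds the conjugate of log G at v0, a point that turns out to lie
    in L. *)
Variables (F G : 'rV[R]_d -> \bar R) (a : 'rV[R]_d) (b p : R).
Hypothesis a_neq0 : a != 0.
Hypothesis p_gt0 : 0 < p.
Hypothesis F_convex : forall x y (t : R), 0 <= t <= 1 ->
  (F ((1 - t) *: x + t *: y) <= (1 - t)%:E * F x + t%:E * F y)%E.
Hypothesis G_convex : forall x y (t : R), 0 <= t <= 1 ->
  (G ((1 - t) *: x + t *: y) <= (1 - t)%:E * G x + t%:E * G y)%E.
Hypothesis F0 : (F 0 < +oo)%E.
Hypothesis le_GF : forall u, (p%:E * G u <= F u)%E.
Hypothesis G_shift : forall u t, G (u + t *: a) = ((expR (t * b))%:E * G u)%E.
Hypothesis F_cvg : forall u, (F u < +oo)%E ->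
  ((expR (- (n%:R * b)))%:E * F (u + n%:R *: a))%E @[n --> \oo] -->
  (p%:E * G u)%E.
Variables (v0 : 'rV[R]_d) (k : R).
Hypothesis k_gt0 : 0 < k.
Hypothesis G_ge : forall u, ((k * expR (dot u v0))%:E <= G u)%E.

Let D := [set u | (F u < +oo)%E].
Let DL := [set u | (G u < +oo)%E].
Let S := add_line D a.
Let J v u := ((dot u v)%:E - lne (G u))%E.

Let G_gt0 u : (0 < G u)%E.
Proof. by rewrite (lt_le_trans _ (G_ge u))// lte_fin mulr_gt0 ?expR_gt0. Qed.

Let F_gt0 u : (0 < F u)%E.
Proof. by rewrite (lt_le_trans _ (le_GF u))// mule_gt0. Qed.

Let G_fin u : DL u -> exists2 g : R, 0 < g & G u = g%:E.
Proof. by move: (G_gt0 u); rewrite /DL /=; case: (G u) => // g g0 _; exists g. Qed.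

Let F_fin u : D u -> exists2 r : R, 0 < r & F u = r%:E.
Proof. by move: (F_gt0 u); rewrite /D /=; case: (F u) => // g g0 _; exists g. Qed.

Let sublevel_convex (H : 'rV[R]_d -> \bar R) :
  (forall x y (t : R), 0 <= t <= 1 ->
    (H ((1 - t) *: x + t *: y)%R <= (1 - t)%:E * H x + t%:E * H y)%E) ->
  (forall u, 0 < H u)%E -> is_convex [set u | (H u < +oo)%E].
Proof.
move=> cH H0 x y t t01 /= Hx Hy; apply: le_lt_trans (cH _ _ _ t01) _.
move: (H0 x) (H0 y) Hx Hy; case: (H x) => // r _; case: (H y) => // s _ _ _.
by rewrite -!EFinM -EFinD ltry.
Qed.

Let D_convex : is_convex D. Proof. exact: sublevel_convex. Qed.
Let DL_convex : is_convex DL. Proof. exact: sublevel_convex. Qed.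

Let sub_D_DL : D `<=` DL.
Proof.
move=> u Du; have := le_lt_trans (le_GF u) Du; rewrite /DL /=.
by move: (G_gt0 u); case: (G u) => [r||]; rewrite ?ltry// gt0_muley.
Qed.

Let DL_shift u (t : R) : DL u -> DL (u + t *: a).
Proof. by move=> /G_fin[g _ Gg]; rewrite /DL /= G_shift Gg -EFinM ltry. Qed.

Let sub_S_DL : S `<=` DL.
Proof.
move=> u [t /sub_D_DL /(@DL_shift _ (- t))].
by rewrite scaleNr addrK.
Qed.

Let J_shift v u (t : R) : dot a v = b -> DL u -> J v (u + t *: a) = J v u.
Proof.
move=> vL /G_fin[g g0 Gg]; rewrite /J G_shift Gg -EFinM.
rewrite !lne_EFin ?mulr_gt0 ?expR_gt0// lnM ?posrE ?expR_gt0// expRK.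
by rewrite dotDl dotZl vL -!EFinB; congr EFin; ring.
Qed.

(** The bound <= follows from p G <= F. For >=, J is constant along a, so u in S may be moved into D
    and then to u + n a, where log F is nearly n b + log (p G(u)) for large n. *)
Let sup_FE v : dot a v = b ->
  ereal_sup [set ((dot u v)%:E - lne (F u))%E | u in setT] =
  (ereal_sup [set J v u | u in S] - (ln p)%:E)%E.
Proof.
move=> vL; apply/eqP; rewrite eq_le; apply/andP; split.
  apply: ge_ereal_sup => _ [u _ <-].
  have [Fu|] := ltP (F u) +oo%E; last by rewrite leye_eq => /eqP ->; rewrite leNye.
  have Su : S u by exists 0; rewrite scale0r addr0.
  have [g g0 Gg] := G_fin (sub_D_DL Fu).
  have [r r0 Fr] := F_fin Fu.
  apply: (@le_trans _ _ (J v u - (ln p)%:E)%E); last first.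
    by apply: leeB => //; apply: ereal_sup_ubound; exists u.
  rewrite /J Fr Gg !lne_EFin// -!EFinB lee_fin.
  have := le_GF u; rewrite Gg Fr -EFinM lee_fin => pgr.
  have : ln (p * g) <= ln r by rewrite ler_ln ?posrE ?mulr_gt0.
  by rewrite lnM ?posrE//; lra.
rewrite leeBlDr//; apply: ge_ereal_sup => _ [u Su <-].
have [t Du] := Su.
rewrite -(J_shift t vL (sub_S_DL Su)).
move: Du; move: (u + t *: a) => {Su t}u Du.
have [g g0 Gg] := G_fin (sub_D_DL Du).
apply/lee_addgt0Pr => e e0.
have pg0 : 0 < p * g by exact: mulr_gt0.
(* The factor e^e becomes the additive error e after taking logarithms. *)
have : nbhs (p%:E * G u)%E [set y | y < (p * g * expR e)%:E]%E.
  apply: open_nbhs_nbhs; split; first exact: open_ereal_lt_ereal.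
  by rewrite /= Gg -EFinM lte_fin ltr_pMr// expR_gt1.
move=> /(F_cvg Du)[n _ /(_ n (leqnn n))] /=.
set u' := u + n%:R *: a.
(* An infinite F(u') would contradict the upper bound just obtained. *)
have [Fu'|] := ltP (F u') +oo%E; last first.
  by rewrite leye_eq => /eqP ->; rewrite gt0_muley ?lte_fin ?expR_gt0.
have [r r0 Fr] := F_fin Fu'.
rewrite Fr -EFinM lte_fin => r_lt.
have ub : ((dot u' v)%:E - lne (F u') <=
    ereal_sup [set ((dot u v)%:E - lne (F u)) | u in setT])%E.
  by apply: ereal_sup_ubound; exists u'.
rewrite -(J_shift n%:R vL (sub_D_DL Du)) -/u'.
apply: (@le_trans _ _ ((dot u' v)%:E - lne (F u') + (ln p)%:E + e%:E)%E); last first.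
  by rewrite leeD2r// leeD2r.
rewrite /J Fr G_shift Gg -EFinM !lne_EFin ?mulr_gt0 ?expR_gt0//.
rewrite -!EFinB -!EFinD lee_fin lnM ?posrE ?expR_gt0// expRK.
have : ln (expR (- (n%:R * b)) * r) <= ln (p * g * expR e).
  by rewrite ler_ln ?posrE ?mulr_gt0 ?expR_gt0// ltW.
by rewrite !lnM ?posrE ?mulr_gt0 ?expR_gt0// !expRK; lra.
Qed.

(** On the segment, convexity of G and ln x <= x - 1 show that J drops below J(u) by at most s times
    a constant. *)
Let segment_limit v u u0 (M : \bar R) : DL u -> DL u0 ->
  (forall s : R, 0 < s <= 1 -> (J v ((1 - s) *: u + s *: u0)%R <= M)%E) ->
  (J v u <= M)%E.
Proof.
move=> Du Du0 JM.
have [g g_gt0 Gu] := G_fin Du; have [g0 g0_gt0 Gu0] := G_fin Du0.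
apply/lee_addgt0Pr => e e0.
(* A positive bound for that constant; s is then chosen with s c <= e. *)
pose c := `|dot u v - dot u0 v + g0 / g - 1| + 1.
have c0 : 0 < c by rewrite ltr_wpDl.
pose s := Num.min 1 (e / c).
have s0 : 0 < s by rewrite lt_min ltr01 divr_gt0.
have s1 : s <= 1 by rewrite ge_min lexx.
have sc : s * c <= e by rewrite -ler_pdivlMr// ge_min lexx orbT.
apply: (@le_trans _ _ (J v ((1 - s) *: u + s *: u0)%R + e%:E)%E); last first.
  by rewrite leeD2r// JM// s0.
have Ds : DL ((1 - s) *: u + s *: u0) by apply: DL_convex; rewrite ?(ltW s0).
have [gs gs_gt0 Gs] := G_fin Ds.
have := @G_convex u u0 s; rewrite (ltW s0) s1 Gs Gu Gu0 => /(_ isT).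
rewrite -!EFinM -EFinD lee_fin => gs_le.
rewrite /J Gs Gu !lne_EFin// -!EFinB -EFinD lee_fin.
rewrite dotDl !dotZl.
have : ln (gs / g) <= gs / g - 1.
  have := le_ln1Dx (x := gs / g - 1); rewrite [1 + _]addrC subrK; apply.
  by have : 0 < gs / g by [rewrite divr_gt0]; lra.
rewrite ln_div ?posrE// => ln_gs.
have gs_g : gs / g <= 1 + s * (g0 / g - 1).
  rewrite ler_pdivrMr//; apply: (le_trans gs_le).
  by rewrite le_eqVlt; apply/orP; left; apply/eqP; field; rewrite gt_eqF.
have : s * (dot u v - dot u0 v + g0 / g - 1) <= e.
  apply: le_trans sc; rewrite ler_pM2l// /c.
  by apply: (le_trans (ler_norm _)); rewrite lerDl.
lra.
Qed.

Let eq_sup_of_rint v : dot a v = b -> rint DL `<=` S ->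
  ereal_sup [set J v u | u in S] = ereal_sup [set J v u | u in setT].
Proof.
move=> vL rS; apply/eqP; rewrite eq_le; apply/andP; split.
  by apply: le_ereal_sup => _ [u _ <-]; exists u.
apply: ge_ereal_sup => _ [u _ <-].
(* Points outside [DL] contribute -oo to the supremum. *)
have [Gu|] := ltP (G u) +oo%E; last first.
  by rewrite leye_eq => /eqP Gu; rewrite /J Gu /= leNye.
have [z DLz] : rint DL !=set0.
  by apply: convex_rint_nonempty => //; exists u.
apply: (segment_limit Gu (rint_sub DLz)) => s /andP[s0 s1].
apply: ereal_sup_ubound; exists ((1 - s) *: u + s *: z) => //; apply: rS.
rewrite addrC -{1}[s](subKr 1); apply: rint_segment => //.
  exact: subset_closure.
by rewrite subr_ge0 s1 ltrBlDr ltrDl.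
Qed.

(** The bound k e^{t a.v0} <= G(ta) = e^{tb} G(0), for all real t, forbids a.v0 to differ from b. *)
Let v0_in_L : dot a v0 = b.
Proof.
have [g g0 Gg] := G_fin (sub_D_DL F0).
apply/eqP; rewrite -subr_eq0; apply: contraT => ne0.
(* This makes t (a.v0 - b) = g/k, so that k e^{g/k} <= g contradicts 1 + x <= e^x. *)
pose t := g / k / (dot a v0 - b).
have := G_ge (0 + t *: a).
rewrite G_shift Gg -EFinM lee_fin add0r dotZl => le_g.
have : k * expR (t * (dot a v0 - b)) <= g.
  rewrite mulrBr expRB mulrA ler_pdivrMr ?expR_gt0//.
  by rewrite mulrC in le_g; rewrite mulrC (le_trans le_g)// mulrC.
rewrite /t divfK// leNgt => /negP[].
have : 1 + g / k <= expR (g / k) by exact: expR_ge1Dx.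
rewrite -(ler_pM2l k_gt0); apply: lt_le_trans.
by rewrite mulrDr mulr1 mulrC divfK ?gt_eqF// ltrDr.
Qed.

(** The separation argument runs along v0 + s w: there [G_ge] bounds J on S by s c - ln k, while
    J(u) grows with slope w.u > c. *)
Let dense_of_eq_sup :
  (forall v, dot a v = b ->
    ereal_sup [set J v u | u in S] = ereal_sup [set J v u | u in setT]) ->
  DL `<=` closure S.
Proof.
move=> eqJ u DLu; apply: contrapT => uS.
have D0 : D 0 := F0.
have S0 : S 0 by exists 0; rewrite scale0r addr0.
have [w [c [cu wS]]] : exists w (c : R), c < dot w u /\
    forall y, S y -> dot w y <= c.
  apply: convex_strict_separation => //; first exact: add_line_convex.
  by exists 0.
(* S contains the whole line Ra, on which w is bounded above. *)
have wa : dot w a = 0.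
  apply/eqP; apply: contraT => wa0.
  have : S (((c + 1) / dot w a) *: a).
    by exists (- ((c + 1) / dot w a)); rewrite scaleNr subrr.
  by move=> /wS; rewrite dotZr divfK//; lra.
have [g g0 Gu] := G_fin DLu.
have bound (s : R) : 0 <= s ->
    dot u v0 + s * dot u w - ln g <= s * c - ln k.
  move=> s0; have vL : dot a (v0 + s *: w) = b.
    by rewrite dotDr dotZr (dotC a w) wa mulr0 addr0.
  have : (J (v0 + s *: w) u <= (s * c - ln k)%:E)%E.
    apply: (@le_trans _ _ (ereal_sup [set J (v0 + s *: w) u | u in setT])).
      by apply: ereal_sup_ubound; exists u.
    rewrite -eqJ//; apply: ge_ereal_sup => _ [y Sy <-].
    have [h h0 Gy] := G_fin (sub_S_DL Sy).
    rewrite /J Gy lne_EFin// -EFinB lee_fin dotDr dotZr.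
    have := G_ge y; rewrite Gy lee_fin => kh.
    have : ln (k * expR (dot y v0)) <= ln h.
      by rewrite ler_ln ?posrE ?mulr_gt0 ?expR_gt0.
    rewrite lnM ?posrE ?expR_gt0// expRK.
    have : s * dot y w <= s * c by rewrite ler_wpM2l// dotC wS.
    lra.
  by rewrite /J Gu lne_EFin// -EFinB lee_fin dotDr dotZr.
have cu' : 0 < dot u w - c by rewrite subr_gt0 dotC.
pose q := ln g - dot u v0 - ln k.
(* [bound] says s (w.u - c) <= q, whereas this s gives |q| + 1. *)
pose s := (`|q| + 1) / (dot u w - c).
have s0 : 0 <= s by apply: divr_ge0; [exact: addr_ge0 | exact: ltW].
have := bound s s0; have := ler_norm q; rewrite {1}/q.
have : s * (dot u w - c) = `|q| + 1 by rewrite divfK// gt_eqF.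
lra.
Qed.

(** Fibres of the projection are lines of direction a, so equal projections mean equal sets after
    adding Ra; [rint DL] is already invariant under such shifts, being [rint D] + Ra in the direct
    implication. *)
Lemma conjugate_eq_rint_eq :
  (forall v, dot a v = b ->
    ereal_sup [set ((dot u v)%:E - lne (F u))%E | u in setT] =
    (ereal_sup [set ((dot u v)%:E - lne (G u))%E | u in setT] - (ln p)%:E)%E)
  <->
  orthoproj (hyperplane a b) @` rint (effdom (fun u => lne (F u))) =
  orthoproj (hyperplane a b) @` rint (effdom (fun u => lne (G u))).
Proof.
have -> : effdom (fun u => lne (F u)) = D.
  by apply/seteqP; split => u; rewrite /effdom /= lne_lty.
have -> : effdom (fun u => lne (G u)) = DL.
  by apply/seteqP; split => u; rewrite /effdom /= lne_lty.
split=> [eqI|eqD v vL].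
  have eqJ v : dot a v = b ->
      ereal_sup [set J v u | u in S] = ereal_sup [set J v u | u in setT].
    move=> vL; have := eqI _ vL; rewrite sup_FE//.
    by move=> /(congr1 (fun z => z + (ln p)%:E)%E); rewrite !subeK.
  have rE : add_line (rint D) a = rint DL.
    rewrite -rint_add_line//; apply: rint_dense_eq => //.
      exact: add_line_convex.
    exact: dense_of_eq_sup.
  apply/seteqP; split=> _ [x rx <-].
    exists x => //; rewrite -rE; exists 0; by rewrite scale0r addr0.
  move: rx; rewrite -rE => -[t rx]; exists (x + t *: a) => //.
  by apply/esym/orthoproj_hyperplane_eq => //; exists t.
rewrite sup_FE// eq_sup_of_rint// => x rx.
have : (orthoproj (hyperplane a b) @` rint D) (orthoproj (hyperplane a b) x).
  by rewrite eqD; exists x.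
move=> [y ry /esym /(orthoproj_hyperplane_eq b x y a_neq0)[t yE]].
by exists t; rewrite -yE; exact: rint_sub.
Qed.

End ConvexDuality.

(** * Moment generating functions *)

Lemma expR_tangent {R : realType} (m x : R) : expR m * (1 + x - m) <= expR x.
Proof.
rewrite -{2}(subrK m x) expRD mulrC ler_pM2r ?expR_gt0//.
by rewrite -addrA; exact: expR_ge1Dx.
Qed.

(** The tangent at the weighted mean m lies below the exponential at x and y, and its linear terms
    cancel on averaging. *)
Lemma expR_convex {R : realType} (x y t : R) : 0 <= t <= 1 ->
  expR ((1 - t) * x + t * y) <= (1 - t) * expR x + t * expR y.
Proof.
move=> /andP[t0 t1]; set m := _ + _.
have t1' : 0 <= 1 - t by rewrite subr_ge0.
apply: le_trans (lerD (ler_wpM2l t1' (expR_tangent m x))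
  (ler_wpM2l t0 (expR_tangent m y))).
rewrite le_eqVlt; apply/orP; left; apply/eqP; rewrite /m; ring.
Qed.

(** * Borel sets and functions on R^d *)

Section BorelRV.
Context {R : realType} {d : nat}.

Lemma open_measurableRV (U : set 'rV[R]_d) :
  open U -> measurable (U : set (borelRV R d)).
Proof. by move=> oU; exact: sub_sigma_algebra. Qed.

Lemma closed_measurableRV (C : set 'rV[R]_d) :
  closed C -> measurable (C : set (borelRV R d)).
Proof.
move=> /closed_openC/open_measurableRV mC.
by rewrite -[C]setCK; exact: measurableC.
Qed.

Lemma continuous_measurableRV (f : 'rV[R]_d -> R) : continuous f ->
  measurable_fun [set: borelRV R d] (f : borelRV R d -> R).
Proof.
move=> /continuousP cf; apply: (measurability _ (RGenOpens.measurableE R)).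
move=> _ [_ [x [y ->] <-]]; rewrite setTI.
by apply: open_measurableRV; apply: cf; exact: interval_open.
Qed.

Lemma hyperplane_measurable (a : 'rV[R]_d) (b : R) :
  measurable (hyperplane a b : set (borelRV R d)).
Proof. by apply: closed_measurableRV; exact: closed_dot_eq. Qed.

Lemma closed_normball (r : R) : closed [set x : 'rV[R]_d | `|x| <= r].
Proof.
apply: (@closed_comp _ _ (fun x : 'rV[R]_d => `|x|) [set t | t <= r]);
  last exact: closed_le.
by move=> x _; exact: norm_continuous.
Qed.

End BorelRV.

Section MomentGeneratingFunction.
Context {disp : measure_display} {T : measurableType disp} {R : realType}.
Context {d : nat} (P : probability T R) (Y : {RV P >-> borelRV R d}).
Implicit Types (u v : 'rV[R]_d).

Definition mgf u : \bar R := (\int[P]_w (expR (dot u (Y w)))%:E)%E.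

Lemma logLaplaceE u : logLaplace P Y u = lne (mgf u).
Proof. by rewrite /logLaplace unlock. Qed.

Lemma preimage_measurableRV (A : set (borelRV R d)) :
  measurable A -> measurable (Y @^-1` A).
Proof. by move=> mA; rewrite -[_ @^-1` _]setTI; exact: measurable_funP. Qed.

Lemma measurable_dotRV u : measurable_fun setT (fun w => dot u (Y w)).
Proof.
apply: (measurableT_comp (f := (dot u : borelRV R d -> R))).
  by apply: continuous_measurableRV; exact: continuous_dotl.
exact: measurable_funP.
Qed.

Lemma measurable_exp_dotRV u :
  measurable_fun setT (EFin \o (fun w => expR (dot u (Y w)))).
Proof.
by apply/measurable_EFinP; apply: measurableT_comp => //; exact: measurable_dotRV.
Qed.

Lemma mgf_integrable u : (mgf u < +oo)%E ->
  P.-integrable setT (fun w => (expR (dot u (Y w)))%:E).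
Proof.
move=> Mfin; apply/integrableP; split; first exact: measurable_exp_dotRV.
by under eq_integral do rewrite /= gtr0_norm ?expR_gt0//.
Qed.

Lemma mgf0 : mgf 0 = 1%E.
Proof.
rewrite /mgf; under eq_integral do rewrite dot0l expR0.
by rewrite (integral_cst P measurableT 1%E) mul1e; exact: probability_setT.
Qed.

Lemma mgf_convex u v (t : R) : 0 <= t <= 1 ->
  (mgf ((1 - t) *: u + t *: v) <= (1 - t)%:E * mgf u + t%:E * mgf v)%E.
Proof.
move=> t01; have /andP[t0 t1] := t01.
have t1' : 0 <= 1 - t by rewrite subr_ge0.
rewrite /mgf -!ge0_integralZl ?lee_fin//;
  try (by move=> w _; rewrite lee_fin expR_ge0); try exact: measurable_exp_dotRV.
rewrite -ge0_integralD//;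
  try (by move=> w _; rewrite mule_ge0// lee_fin ?expR_ge0);
  try (by apply: measurable_funeM; exact: measurable_exp_dotRV).
apply: ge0_le_integral => //.
- exact: measurable_exp_dotRV.
- exact: emeasurable_funD (measurable_funeM _ (measurable_exp_dotRV u))
    (measurable_funeM _ (measurable_exp_dotRV v)).
- by move=> w _; rewrite -!EFinM -EFinD lee_fin dotDl !dotZl expR_convex.
Qed.

(** Countably many balls cover the space and cannot all be null. *)
Lemma exists_charged_ball :
  exists n : nat, (0 < P (Y @^-1` [set x : 'rV[R]_d | (`|x| <= n%:R)%R]))%E.
Proof.
apply: contrapT => noball.
have null : P.-negligible (\bigcup_n Y @^-1` [set x : 'rV[R]_d | (`|x| <= n%:R)%R]).
  apply: negligible_bigcup => n.
  set B := _ @^-1` _.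
  have mB : measurable B.
    by apply: preimage_measurableRV; apply: closed_measurableRV; exact: closed_normball.
  exists B; split => //; apply/eqP; rewrite eq_le measure_ge0 andbT leNgt.
  by apply/negP => B0; apply: noball; exists n.
have allT : \bigcup_n Y @^-1` [set x : 'rV[R]_d | (`|x| <= n%:R)%R] = setT.
  rewrite -subTset => w _; exists (Num.trunc `|Y w : 'rV[R]_d|).+1 => //=.
  by rewrite ltW// truncnS_gt.
rewrite allT in null.
have : (1 = 0 :> \bar R)%E.
  exact: etrans (esym (probability_setT P)) (measure_negligible measurableT null).
by move=> /eqP; rewrite onee_eq0.
Qed.

(* [v] is the mean of [Y] conditioned on a ball; the bound is Jensen's
   inequality there. *)
Lemma mgf_ge_exp : exists v (k : R), 0 < k /\
  forall u, ((k * expR (dot u v))%:E <= mgf u)%E.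
Proof.
have [n] := exists_charged_ball.
set B := _ @^-1` _ => PB0.
have mB : measurable B.
  by apply: preimage_measurableRV; apply: closed_measurableRV; exact: closed_normball.
have PBfin : P B = (fine (P B))%:E by rewrite fineK// fin_num_measure.
set q := fine (P B) in PBfin.
have q0 : 0 < q by move: PB0; rewrite PBfin lte_fin.
have mY i : measurable_fun [set: T] (fun w => (Y w : 'rV[R]_d) 0 i : R).
  apply: (measurableT_comp (f := (fun x : 'rV[R]_d => x 0 i) : borelRV R d -> R)).
    by apply: continuous_measurableRV; exact: coord_continuous.
  exact: measurable_funP.
have intY i : P.-integrable B (fun w => ((Y w : 'rV[R]_d) 0 i)%:E).
  apply: measurable_bounded_integrable => //.
  - by rewrite ltey_eq fin_num_measure.
  - exact: measurable_funTS (mY i).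
  - exists n%:R; split; first exact: num_real.
    move=> M ltM w Bw; apply: le_trans (ltW ltM).
    exact: le_trans (ler_coord_norm _ _) Bw.
have intYfin i : (\int[P]_(w in B) ((Y w : 'rV[R]_d) 0 i)%:E)%E \is a fin_num.
  exact: integrable_fin_num.
pose I i := fine (\int[P]_(w in B) ((Y w : 'rV[R]_d) 0 i)%:E)%E.
pose v : 'rV[R]_d := \row_i (I i / q).
exists v, q; split=> // u.
pose m := dot u v; rewrite -/m.
(* The tangent to the exponential at m = u.v, expanded in coordinates so that it integrates term by
   term; since v is the conditional mean, its integral over [B] is exactly q e^m. *)
pose f w := ((expR m * (1 - m))%:E +
  \sum_(i < d) ((expR m * u 0 i)%:E * ((Y w : 'rV[R]_d) 0 i)%:E))%E.
have fE w : f w = (expR m * (1 + dot u (Y w) - m))%:E.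
  rewrite /f; under eq_bigr do rewrite -EFinM.
  rewrite sumEFin -EFinD; congr EFin.
  under eq_bigr do rewrite -mulrA.
  rewrite -mulr_sumr -/(dot u (Y w)); ring.
have int_term i :
    P.-integrable B (fun w => (expR m * u 0 i)%:E * ((Y w : 'rV[R]_d) 0 i)%:E)%E.
  exact: integrableZl.
have int_sum : P.-integrable B
    (fun w => \sum_(i < d) ((expR m * u 0 i)%:E * ((Y w : 'rV[R]_d) 0 i)%:E))%E.
  exact: integrable_sum.
have int_cst : P.-integrable B (fun _ => (expR m * (1 - m))%:E).
  exact: finite_measure_integrable_cst.
have -> : ((q * expR m)%:E = \int[P]_(w in B) f w)%E.
  rewrite integralD// integral_cst// integral_sum//.
  under eq_bigr do rewrite integralZl// -(fineK (intYfin _)) -EFinM.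
  rewrite sumEFin [X in (_ * X)%E]PBfin -EFinM -EFinD; congr EFin.
  under eq_bigr do rewrite -mulrA.
  rewrite -mulr_sumr.
  have -> : \sum_(i < d) u 0 i * I i = q * m.
    rewrite /m /dot mulr_sumr; apply: eq_bigr => i _; rewrite mxE.
    by field; rewrite gt_eqF.
  ring.
have [Mfin|] := ltP (mgf u) +oo%E; last by rewrite leye_eq => /eqP ->; rewrite leey.
apply: (@le_trans _ _ (\int[P]_(w in B) (expR (dot u (Y w)))%:E)%E).
  apply: le_integral => //.
  - exact: integrableD.
  - by apply: integrableS (mgf_integrable Mfin).
  - by move=> w _; rewrite fE lee_fin expR_tangent.
by apply: ge0_subset_integral => //; exact: measurable_exp_dotRV.
Qed.

(** Each point of K avoids some closed set of probability 1, whose complement is a null open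
    neighbourhood; finitely many of these cover K. *)
Lemma compact_disjoint_tsupp (K : set 'rV[R]_d) : compact K ->
  K `&` tsupp P Y = set0 -> P.-negligible (Y @^-1` K).
Proof.
move=> cK K0.
have nbhsK x : exists U : set 'rV[R]_d,
    [/\ open U, K x -> U x & P.-negligible (Y @^-1` U)].
  have [Kx|Kx] := pselect (K x); last first.
    by exists set0; split=> //; rewrite preimage_set0; exact: negligible_set0.
  have /existsNP[C /not_implyP[[clC PC] Cx]] : ~ tsupp P Y x.
    by move=> Yx; have : (K `&` tsupp P Y) x by []; rewrite K0.
  exists (~` C); split; [exact: closed_openC | by [] |].
  have mC : measurable (Y @^-1` C).
    by apply: preimage_measurableRV; exact: closed_measurableRV.
  exists (~` (Y @^-1` C)); split=> //; first exact: measurableC.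
  by rewrite probability_setC// PC subee.
have [U /all_and3[oU KU U0]] := choice nbhsK.
move: cK; rewrite compact_cover => /(_ _ setT U (fun x _ => oU x)).
case=> [x Kx|D _ KD]; first by exists x => //; exact: KU.
apply: (@negligibleS _ _ _ _ (\big[setU/set0]_(x <- finmap.enum_fset D) Y @^-1` U x)).
  move=> w /KD [x Dx Ux]; rewrite -bigcup_seq; exists x => //.
by apply: big_ind => //; [exact: negligible_set0 | exact: negligibleU].
Qed.

(** The open half-space beyond b is a countable union of compact sets that miss the support. *)
Lemma halfspace_negligible (a : 'rV[R]_d) (b : R) :
  tsupp P Y `<=` halfspace a b -> P.-negligible [set w | b < dot a (Y w)].
Proof.
move=> supp.
pose K n : set 'rV[R]_d :=
  [set x | b + n.+1%:R^-1 <= dot a x] `&` [set x | `|x| <= n%:R].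
apply: (@negligibleS _ _ _ _ (\bigcup_n Y @^-1` K n)).
  move=> w /=; set x : 'rV[R]_d := Y w => bx.
  have e0 : 0 < dot a x - b by rewrite subr_gt0.
  (* Large enough for both |x| <= N and 1/(N+1) <= a.x - b. *)
  pose N := maxn (Num.trunc `|x|).+1 (Num.trunc (dot a x - b)^-1).
  exists N => //; rewrite /K; split=> /=; last first.
    apply: (le_trans (ltW (truncnS_gt _))).
    by rewrite ler_nat leq_maxl.
  rewrite -lerBrDl invf_ple ?posrE//.
  apply: (le_trans (ltW (truncnS_gt _))).
  by rewrite ler_nat ltnS leq_maxr.
apply: negligible_bigcup => n; apply: compact_disjoint_tsupp.
  apply: bounded_closed_compact.
    exists n%:R; split; first exact: num_real.
    by move=> M ltM x [_ /= xn]; exact: le_trans xn (ltW ltM).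
  apply: closedI; last exact: closed_normball.
  apply: (@closed_comp _ _ (dot a) [set t | b + n.+1%:R^-1 <= t]);
    last exact: closed_ge.
  by move=> x _; exact: continuous_dotl.
rewrite -subset0 => x [[/= bx _] /supp]; rewrite /halfspace /= => xb.
by have := le_trans bx xb; rewrite gerDl leNgt invr_gt0 ltr0n.
Qed.

End MomentGeneratingFunction.

(** * Tilting towards the face *)

Section FaceLimit.
Context {disp : measure_display} {T : measurableType disp} {R : realType}.
Context {d : nat} (P : probability T R) (X : {RV P >-> borelRV R d}).
Context (a : 'rV[R]_d) (b : R).
Hypothesis X_halfspace : P.-negligible [set w | b < dot a (X w)].
Implicit Types (u : 'rV[R]_d).

Let L := X @^-1` hyperplane a b.

Let measurable_L : measurable L.
Proof. by apply: preimage_measurableRV; exact: hyperplane_measurable. Qed.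

(** The unnormalised transform of X|L: no division by P(X in L). *)
Definition face_mgf u : \bar R := (\int[P]_(w in L) (expR (dot u (X w)))%:E)%E.

Lemma face_mgf_le u : (face_mgf u <= mgf X u)%E.
Proof. by apply: ge0_subset_integral => //; exact: measurable_exp_dotRV. Qed.

Lemma face_mgf_shift u (t : R) :
  face_mgf (u + t *: a) = ((expR (t * b))%:E * face_mgf u)%E.
Proof.
rewrite /face_mgf -ge0_integralZl//; last first.
  by apply: measurable_funTS; exact: measurable_exp_dotRV.
apply: eq_integral => w; rewrite inE => Lw.
rewrite dotDl dotZl (_ : dot a (X w) = b); last exact: Lw.
by rewrite addrC expRD EFinM.
Qed.

(** The integrand is e^{u.X} times the n-th power of e^{a.X - b}, a ratio equal to 1 on the face and
    almost surely below 1 off it. Dominated convergence applies with e^{u.X} as the dominating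
    function. *)
Lemma face_mgf_cvg u : (mgf X u < +oo)%E ->
  ((expR (- (n%:R * b)))%:E * mgf X (u + n%:R *: a))%E @[n --> \oo] -->
  face_mgf u.
Proof.
move=> Mfin.
pose f n w := ((expR (- (n%:R * b)))%:E *
  (expR (dot (u + n%:R *: a)%R (X w)))%:E)%E.
pose g w := (expR (dot u (X w)))%:E.
have fE n w : f n w = (expR (dot u (X w)) * expR (n%:R * (dot a (X w) - b)))%:E.
  rewrite /f -EFinM -!expRD; congr (expR _)%:E.
  by rewrite dotDl dotZl; ring.
rewrite /face_mgf integral_mkcond.
rewrite (_ : (fun n => _) = (fun n => \int[P]_w f n w)%E); last first.
  apply/funext => n; rewrite /mgf -ge0_integralZl//.
  exact: measurable_exp_dotRV.
have [] // := @dominated_convergence _ _ _ P _ measurableT f (g \_ L) g.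
- move=> n; apply: measurable_funeM; exact: measurable_exp_dotRV.
- apply/(measurable_restrictT _ measurable_L).
  by apply: measurable_funTS; exact: measurable_exp_dotRV.
- apply: negligibleS X_halfspace => w /= /not_implyP[_ ncvg].
  rewrite ltNge; apply/negP => le_b; apply: ncvg.
  have -> : f ^~ w = EFin \o
      geometric (expR (dot u (X w))) (expR (dot a (X w) - b)).
    by apply/funext => n; rewrite fE expRM_natl.
  rewrite patchE; case: ifPn => [|]; rewrite ?inE ?notin_setE => Lw.
    rewrite (_ : dot a (X w) = b); last exact: Lw.
    rewrite subrr expR0 (_ : EFin \o _ = cst (expR (dot u (X w)))%:E).
      exact: cvg_cst.
    by apply/funext => n; rewrite /geometric /= expr1n mulr1.
  apply: cvg_EFin; first exact: nearW.
  apply: cvg_geometric; rewrite ger0_norm ?expR_ge0// -expR0 ltr_expR.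
  by rewrite subr_lt0 lt_neqAle le_b andbT; apply/eqP.
- exact: mgf_integrable.
- apply: negligibleS X_halfspace => w /= nle.
  rewrite ltNge; apply/negP => le_b; apply: nle => n _.
  change (`|f n w| <= g w)%E.
  rewrite fE gee0_abs ?lee_fin ?mulr_ge0 ?expR_ge0//.
  rewrite ler_piMr ?expR_ge0// -expR0 ler_expR.
  by rewrite mulr_ge0_le0// subr_le0.
Qed.

End FaceLimit.

(** * The transform of the conditioned vector *)

Section Conditioned.
Context {disp disp' : measure_display}.
Context {T : measurableType disp} {T' : measurableType disp'} {R : realType}.
Context {d : nat} (P : probability T R) (P' : probability T' R).
Context (X : {RV P >-> borelRV R d}) (Y : {RV P' >-> borelRV R d}).
Context (a : 'rV[R]_d) (b : R).
Let L := hyperplane a b.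
Hypothesis PL0 : (0 < P (X @^-1` L))%E.
Hypothesis condY : conditioned_on P X L P' Y.

(** Both integrals are transported to R^d, where on L the law of Y is 1/p times the law of X. *)
Lemma face_mgf_conditioned u :
  ((fine (P (X @^-1` L)))%:E * mgf Y u)%E = face_mgf X a b u.
Proof.
have mL : measurable (L : set (borelRV R d)) by exact: hyperplane_measurable.
have mXL := preimage_measurableRV X mL.
have mYL := preimage_measurableRV Y mL.
set p := fine _.
have PLp : P (X @^-1` L) = p%:E by rewrite fineK// fin_num_measure.
have p0 : 0 < p by move: PL0; rewrite PLp lte_fin.
pose e : borelRV R d -> \bar R := fun x => (expR (dot u x))%:E.
have me : measurable_fun setT e.
  apply/measurable_EFinP; apply: measurableT_comp => //.
  by apply: continuous_measurableRV; exact: continuous_dotl.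
have e0 x : (0 <= e x)%E by rewrite lee_fin expR_ge0.
(* Taking A = L in [condY] shows that Y lies in L almost surely. *)
have YL : P' (~` (Y @^-1` L)) = 0%E.
  rewrite probability_setC// condY// setIid PLp inver gt_eqF// -EFinM divff ?gt_eqF//.
  by rewrite subee.
have -> : mgf Y u = (\int[P']_(w in Y @^-1` L) (e \o Y) w)%E.
  rewrite /mgf (ge0_negligible_integral (N := ~` (Y @^-1` L)))//.
  - by rewrite setTD setCK.
  - exact: measurableC.
  - exact: measurable_exp_dotRV.
have -> : face_mgf X a b u = (\int[P]_(w in X @^-1` L) (e \o X) w)%E by [].
have pushE (disp'' : measure_display) (S : measurableType disp'')
    (Q : probability S R) (Z : {RV Q >-> borelRV R d}) :
    (\int[Q]_(w in Z @^-1` L) (e \o Z) w)%E =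
    (\int[distribution Q Z]_(x in L) e x)%E.
  by rewrite -ge0_integral_pushforward//; exact: measurable_funTS.
rewrite !pushE.
have pV0 : 0 <= p^-1 by rewrite invr_ge0 ltW.
rewrite (eq_measure_integral (mscale (NngNum pV0) (distribution P X))).
  rewrite ge0_integral_mscale//; last exact: measurable_funTS.
  by rewrite muleA -EFinM divff ?gt_eqF// mul1e.
move=> A mA AL; rewrite [LHS](condY mA) (setIidl _); last by move=> w /AL.
by rewrite [X in (_ / X)%E]PLp inver gt_eqF// muleC.
Qed.

End Conditioned.

(** * The equivalence for X and X|L *)

Theorem theorem1 (R : realType) (d : nat) (hd : (1 <= d)%N)
    (disp disp' : measure_display)
    (T : measurableType disp) (T' : measurableType disp')
    (P : probability T R) (P' : probability T' R)
    (X : {RV P >-> borelRV R d}) (XL : {RV P' >-> borelRV R d})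
    (L : set 'rV[R]_d)
    (hL : supporting_hyperplane L (convex_support P X))
    (hPL : (0 < P (X @^-1` L) < 1)%E)
    (hXL : conditioned_on P X L P' XL) :
  (forall v : 'rV[R]_d, L v ->
     rate_fun P X v = (rate_fun P' XL v - lne (P (X @^-1` L)))%E) <->
  orthoproj L @` rint (effdom (logLaplace P X)) =
  orthoproj L @` rint (effdom (logLaplace P' XL)).

Proof.
have [_ [a [b [a0 LE supp]]]] := hL; subst L.
have [PL0 _] := andP hPL.
have X_halfspace : P.-negligible [set w | b < dot a (X w)].
  by apply: halfspace_negligible => x Tx; apply: supp; exact: sub_smallest Tx.
set PL := P (X @^-1` _).
have PLfin : PL = (fine PL)%:E.
  rewrite fineK// fin_num_measure//.
  by apply: preimage_measurableRV; exact: hyperplane_measurable.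
have p0 : 0 < fine PL by rewrite -lte_fin -PLfin.
have faceE := face_mgf_conditioned PL0 hXL.
have [v [k [k0 Yk]]] := mgf_ge_exp XL.
(* The shift identity of [face_mgf], with the factor P(X in L) cancelled. *)
have G_shift u t : mgf XL (u + t *: a) = ((expR (t * b))%:E * mgf XL u)%E.
  have := face_mgf_shift X a b u t; rewrite -!faceE -/PL muleCA.
  move=> /(congr1 (fun z => ((fine PL)^-1)%:E * z)%E).
  by rewrite /= !(muleA (_^-1)%:E) -!EFinM mulVf ?gt_eqF// !mul1e.
have F0 : (mgf X 0 < +oo)%E by rewrite mgf0 ltry.
have le_GF u : ((fine PL)%:E * mgf XL u <= mgf X u)%E.
  by rewrite faceE face_mgf_le.
have F_cvg u : (mgf X u < +oo)%E ->
    ((expR (- (n%:R * b)))%:E * mgf X (u + n%:R *: a))%E @[n --> \oo] -->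
    ((fine PL)%:E * mgf XL u)%E.
  by move=> Xu; rewrite faceE; exact: face_mgf_cvg.
have := conjugate_eq_rint_eq a0 p0 (mgf_convex X) (mgf_convex XL) F0 le_GF
  G_shift F_cvg k0 Yk.
have KX : logLaplace P X = fun u => lne (mgf X u).
  by apply/funext => u; exact: logLaplaceE.
have KXL : logLaplace P' XL = fun u => lne (mgf XL u).
  by apply/funext => u; exact: logLaplaceE.
rewrite /rate_fun KX KXL PLfin lne_EFin//.
Qed.
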